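(* Let $\Gamma$ be a finite simple graph that is not complete. Label every vertex with the free group $\mathbb{F}_2$ and denote by $G_\Gamma$ the graph product group. There exist a finite simple graph $\Gamma'$ and a labeling of its vertices with either $\mathbb{F}_2$ or $\mathbb{F}_3$ such that $\Gamma' \not\cong \Gamma$, but the graph product $G_{\Gamma'}$ is isomorphic with a subgroup of $G_\Gamma$ of index $2$. Moreover, when $\Gamma$ is rigid, also $\Gamma'$ can be chosen rigid.
   Context: A simple graph with vertex set $S$ is a symmetric relation $\sim$ on $S$ with $s \not\sim s$ for all $s$; it is complete if $s \sim t$ for all distinct $s,t \in S$. For $s \in S$, $\operatorname{link} s = \{t \in S \mid t \sim s\}$; for $U \subset S$, $\operatorname{link}(U) = \bigcap_{u \in U}\operatorname{link} u$ (equal to $S$ if $U=\emptyset$). The graph is rigid if $\operatorname{link}(\operatorname{link} s) = \{s\}$ for all $s \in S$. The graph product of groups $(G_s)_{s\in S}$ is the quotient of the free product of the $G_s$ by the relations that $G_s$ and $G_t$ commute whenever $s \sim t$. $\mathbb{F}_n$ is the free group on $n$ generators. *)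

(* Defs.v *)
From HB Require Import structures.
From mathcomp Require Import all_boot.
From mathcomp Require Import boolp classical_sets functions cardinality.

Set Implicit Arguments.
Unset Strict Implicit.
Unset Printing Implicit Defensive.

Local Open Scope group_scope.
Local Open Scope quotient_scope.

Record sgraph := SGraph {
  vertex :> finType;
  edge : rel vertex;
  edge_sym : symmetric edge;
  edge_irrefl : irreflexive edge
}.

Arguments edge {_}.

Definition complete (Gamma : sgraph) : Prop :=
  forall s t : Gamma, s != t -> edge s t.

Definition link1 (Gamma : sgraph) (s : Gamma) : {set Gamma} :=
  [set t | edge t s].

Definition link (Gamma : sgraph) (U : {set Gamma}) : {set Gamma} :=
  \bigcap_(u in U) link1 u.

Definition rigid (Gamma : sgraph) : Prop :=
  forall s : Gamma, link (link1 s) = [set s].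

Definition graph_isomorphic (Gamma Delta : sgraph) : Prop :=
  exists2 f : Gamma -> Delta, bijective f & {mono f : s t / edge s t}.

(* The least congruence containing R; on a group, quotienting by it amounts to
   quotienting by the normal closure of the elements x^-1 * y with R x y. *)
Inductive cong (M : monoidType) (R : M -> M -> Prop) : M -> M -> Prop :=
| cong_base x y : R x y -> cong R x y
| cong_refl x : cong R x x
| cong_sym x y : cong R x y -> cong R y x
| cong_trans x y z : cong R x y -> cong R y z -> cong R x z
| cong_mul x x' y y' :
    cong R x x' -> cong R y y' -> cong R (x * y) (x' * y').

Section Quotient.
Variables (M : monoidType) (R : M -> M -> Prop).

Definition congb : rel M := fun x y => `[< cong R x y >].

Fact congb_refl : reflexive congb.
Proof. by move=> x; apply/asboolP/cong_refl. Qed.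

Fact congb_sym : symmetric congb.
Proof. by move=> x y; apply/asboolP/asboolP; apply: cong_sym. Qed.

Fact congb_trans : transitive congb.
Proof.
by move=> y x z /asboolP xy /asboolP yz; apply/asboolP/(cong_trans xy yz).
Qed.

Canonical congb_equiv := EquivRel congb congb_refl congb_sym congb_trans.

Definition quot := {eq_quot congb_equiv}.

HB.instance Definition _ := Choice.on quot.
HB.instance Definition _ := EqQuotient.on quot.

Definition to_quot (x : M) : quot := \pi_quot x.

Lemma to_quotP x y : to_quot x = to_quot y <-> cong R x y.
Proof.
by split=> [/eqquotP/asboolP//|xy]; apply/eqquotP/asboolP.
Qed.

Lemma to_quotK (a : quot) : to_quot (repr a) = a.
Proof. exact: reprK. Qed.

Definition quot_one : quot := to_quot 1.
Definition quot_mul (a b : quot) : quot := to_quot (repr a * repr b).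

Lemma quot_mulE x y : quot_mul (to_quot x) (to_quot y) = to_quot (x * y).
Proof. by apply/to_quotP/cong_mul; apply/to_quotP; rewrite to_quotK. Qed.

Fact quot_mulA : associative quot_mul.
Proof.
move=> a b c; rewrite -(to_quotK a) -(to_quotK b) -(to_quotK c).
by rewrite !quot_mulE mulgA.
Qed.

Fact quot_mul1 : left_id quot_one quot_mul.
Proof. by move=> a; rewrite -(to_quotK a) quot_mulE mul1g. Qed.

Fact quot_mulr1 : right_id quot_one quot_mul.
Proof. by move=> a; rewrite -(to_quotK a) quot_mulE mulg1. Qed.

HB.instance Definition _ := isMonoid.Build quot quot_mulA quot_mul1 quot_mulr1.

Lemma to_quotM x y : to_quot (x * y) = to_quot x * to_quot y.
Proof. by rewrite -quot_mulE. Qed.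

Lemma to_quot1 : to_quot 1 = 1.
Proof. by []. Qed.

End Quotient.

Section QuotientGroup.
Variables (G : groupType) (R : G -> G -> Prop).

Definition quot_group := @quot G R.

HB.instance Definition _ := Monoid.on quot_group.

Definition quot_inv (a : quot_group) : quot_group := to_quot R (repr a)^-1.

Fact quot_mulV : left_inverse 1 quot_inv *%g.
Proof.
by move=> a; rewrite -{2}(to_quotK a) -to_quotM mulVg to_quot1.
Qed.

Fact quot_mulrV : right_inverse 1 quot_inv *%g.
Proof.
by move=> a; rewrite -{1}(to_quotK a) -to_quotM mulgV to_quot1.
Qed.

HB.instance Definition _ := hasInv.Build quot_group quot_inv.
HB.instance Definition _ := Monoid_isGroup.Build quot_group quot_mulV quot_mulrV.

End QuotientGroup.

(* The free monoid on X: multiplication is concatenation. *)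
Definition word (X : choiceType) := seq X.

HB.instance Definition _ (X : choiceType) := Choice.on (word X).
HB.instance Definition _ (X : choiceType) :=
  isMonoid.Build (word X) (@catA X) (@cat0s X) (@cats0 X).

Section WordGroup.
Variables (X : choiceType) (R : word X -> word X -> Prop) (inv : X -> X).
Hypothesis invl : forall x, cong R [:: inv x; x] [::].
Hypothesis invr : forall x, cong R [:: x; inv x] [::].

Definition word_inv (a : quot R) : quot R :=
  to_quot R (rev (map inv (repr a))).

Fact word_mulV : left_inverse 1 word_inv *%g.
Proof.
move=> a; rewrite -{2}(to_quotK a) -to_quotM; apply/to_quotP.
elim: (repr a) => [|x w IHw] /=; first exact: cong_refl.
rewrite rev_cons -cats1.
have -> : (rev (map inv w) ++ [:: inv x] : word X) * (x :: w : word X)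
  = (rev (map inv w) : word X) * (([:: inv x; x] : word X) * (w : word X)).
  exact: (esym (catA _ _ _)).
apply: cong_trans IHw; apply: cong_mul (cong_refl _ _) _.
exact: (cong_mul (invl x) (cong_refl R (w : word X))).
Qed.

Fact word_mulrV : right_inverse 1 word_inv *%g.
Proof.
move=> a; rewrite -{1}(to_quotK a) -to_quotM; apply/to_quotP.
elim: (repr a) => [|x w IHw] /=; first exact: cong_refl.
rewrite rev_cons -cats1.
have -> : (x :: w : word X) * (rev (map inv w) ++ [:: inv x] : word X)
  = ([:: x] : word X) *
    (((w : word X) * (rev (map inv w) : word X)) * ([:: inv x] : word X)).
  by congr cons; apply: catA.
apply: cong_trans (invr x).
apply: (@cong_mul _ R [:: x] [:: x] _ [:: inv x] (cong_refl _ _)).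
exact: (cong_mul IHw (cong_refl R ([:: inv x] : word X))).
Qed.

End WordGroup.

Section FreeGroup.
Variable n : nat.

(* (i, true) is the i-th generator and (i, false) its formal inverse. *)
Definition free_letter : choiceType := ('I_n * bool)%type.

Definition free_letter_inv (x : free_letter) : free_letter := (x.1, ~~ x.2).

Inductive free_rel : word free_letter -> word free_letter -> Prop :=
| FreeRel x : free_rel [:: x; free_letter_inv x] [::].

Definition free_group := quot free_rel.

HB.instance Definition _ := Monoid.on free_group.

Fact free_invr x : cong free_rel [:: x; free_letter_inv x] [::].
Proof. exact/cong_base/FreeRel. Qed.

Fact free_invl x : cong free_rel [:: free_letter_inv x; x] [::].
Proof.
have {2}-> : x = free_letter_inv (free_letter_inv x).
  by case: x => i b; rewrite /free_letter_inv /= negbK.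
exact: free_invr.
Qed.

HB.instance Definition _ :=
  hasInv.Build free_group (@word_inv _ free_rel free_letter_inv).
HB.instance Definition _ := Monoid_isGroup.Build free_group
  (word_mulV free_invl) (word_mulrV free_invr).

End FreeGroup.

Section FreeProduct.
Variables (S : choiceType) (G : S -> groupType).

Definition prod_letter : choiceType := {s : S & G s}.

Definition prod_letter_inv (x : prod_letter) : prod_letter :=
  Tagged G (tagged x)^-1.

(* The free product is the free monoid on the disjoint union of the factors,
   modulo the multiplication tables of the factors and their units. *)
Inductive prod_rel : word prod_letter -> word prod_letter -> Prop :=
| ProdRelM s (g h : G s) :
    prod_rel [:: Tagged G g; Tagged G h] [:: Tagged G (g * h)]
| ProdRel1 s : prod_rel [:: Tagged G (1 : G s)] [::].

Definition free_product := quot prod_rel.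

HB.instance Definition _ := Monoid.on free_product.

Fact prod_invl x : cong prod_rel [:: prod_letter_inv x; x] [::].
Proof.
case: x => s g; apply: cong_trans (cong_base (ProdRel1 s)).
by rewrite -(mulVg g); apply/cong_base/ProdRelM.
Qed.

Fact prod_invr x : cong prod_rel [:: x; prod_letter_inv x] [::].
Proof.
case: x => s g; apply: cong_trans (cong_base (ProdRel1 s)).
by rewrite -(mulgV g); apply/cong_base/ProdRelM.
Qed.

HB.instance Definition _ :=
  hasInv.Build free_product (@word_inv _ prod_rel prod_letter_inv).
HB.instance Definition _ := Monoid_isGroup.Build free_product
  (word_mulV prod_invl) (word_mulrV prod_invr).

Definition prod_in (s : S) (g : G s) : free_product :=
  to_quot prod_rel [:: Tagged G g].

End FreeProduct.

Section GraphProduct.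
Variables (Gamma : sgraph) (G : Gamma -> groupType).

Inductive graph_rel : free_product G -> free_product G -> Prop :=
| GraphRel (s t : Gamma) (g : G s) (h : G t) : edge s t ->
    graph_rel (prod_in g * prod_in h) (prod_in h * prod_in g).

Definition graph_product : groupType := quot_group graph_rel.

End GraphProduct.

Definition lcoset_of (G : groupType) (H : {pred G}) (g : G) : set G :=
  [set g * h | h in [set` H]]%classic.

Definition has_index (G : groupType) (H : {pred G}) (n : nat) : Prop :=
  (range (lcoset_of H) #= `I_n)%card.

(* A map of groups that preserves multiplication preserves units and inverses,
   so f is a group isomorphism from K onto H. *)
Definition isomorphic_to_subgroup (K G : groupType) (H : {pred G}) : Prop :=
  exists f : {multiplicative K -> G}, set_bij [set: K] [set` H] f.

(* Main.v *)
From HB Require Import structures.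
Require Import Defs.
From mathcomp Require Import all_boot.
From mathcomp Require Import boolp classical_sets functions cardinality.

(* Choose a vertex s0 that is not adjacent to some other vertex, let a, b be the
   generators at s0, and let H be the kernel of the map G_Gamma -> Z/2 sending
   a to 1 and every other generator to 0. Then Gamma' is two copies of Gamma
   glued along the star of s0: s0 gets rank 3, with generators a^2, b, a^-1 b a,
   and a generator g in the second copy stands for a^-1 g a. That these elements
   satisfy no further relation is seen by letting G_Gamma act on K * Z/2, where
   K = G_Gamma', as it acts on itself by left multiplication when (k, e) stands
   for a^e k (Kaloujnine-Krasner): this is a morphism psi from G_Gamma to the
   wreath product of K with Z/2, and a coordinate of psi inverts K -> H. Rigidity
   is inherited because it says that link s is contained in link t only if
   s = t. *)

Set Implicit Arguments.
Unset Strict Implicit.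
Unset Printing Implicit Defensive.

Local Open Scope group_scope.

(** * Universal properties of quotients and free groups *)

(** The pairs that [h] identifies form a congruence containing [R], hence containing [cong R]. The
    monoid form serves quotients of words and of free products alike. *)
Lemma quot_hom (M T : monoidType) (R : M -> M -> Prop) (h : M -> T) :
    {morph h : x y / x * y} -> (forall x y, R x y -> h x = h y) ->
  exists2 F : quot R -> T,
    {morph F : x y / x * y} & forall x, F (to_quot R x) = h x.
Proof.
move=> hM hR; have hcong x y : cong R x y -> h x = h y.
  elim=> {x y} [x y /hR//|//|x y _ ->//|x y z _ -> _ ->//|].
  by move=> x x' y y' _ xx' _ yy'; rewrite !hM xx' yy'.
have Fh x : h (repr (to_quot R x)) = h x.
  by apply/hcong/to_quotP; rewrite to_quotK.
exists (fun a => h (repr a)) => // a b.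
by rewrite -(to_quotK a) -(to_quotK b) -to_quotM !Fh hM.
Qed.

Definition pack_hom (G H : magmaType) (f : G -> H)
    (fM : {morph f : x y / x * y}) : {multiplicative G -> H} :=
  HB.pack f (isMultiplicative.Build G H f fM).

(** The predicates for which induction on group elements reduces to generators. *)
Definition subgroup_prop (G : groupType) (P : G -> Prop) : Prop :=
  [/\ P 1, forall x y, P x -> P y -> P (x * y) & forall x, P x -> P x^-1].

Lemma hom1 (G H : groupType) (f : {multiplicative G -> H}) : f 1 = 1.
Proof. by apply: (mulgI (f 1)); rewrite -gmulfM !mulg1. Qed.

Lemma homV (G H : groupType) (f : {multiplicative G -> H}) :
  {morph f : x / x^-1}.
Proof. by move=> x; apply/esym/mulg1_eq; rewrite -gmulfM mulgV hom1. Qed.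

Lemma commute_subgroup (G : groupType) (x : G) : subgroup_prop (commute x).
Proof.
by split=> [|y z|y]; [apply: commute1 | apply: commuteM | apply: commuteV].
Qed.

Lemma preim_subgroup (G H : groupType) (f : {multiplicative G -> H})
  (P : H -> Prop) : subgroup_prop P -> subgroup_prop (fun x => P (f x)).
Proof.
case=> P1 PM PV; split=> [|x y Px Py|x Px]; first by rewrite hom1.
- by rewrite gmulfM; apply: PM.
- by rewrite homV; apply: PV.
Qed.

(* The junk value for i >= n is 1. *)
Definition free_gen n (i : nat) : free_group n :=
  if insub i is Some j then to_quot (@free_rel n) [:: (j, true)] else 1.

Lemma free_genE n (j : 'I_n) :
  free_gen n j = to_quot (@free_rel n) [:: (j, true)].
Proof. by rewrite /free_gen valK. Qed.

Lemma free_group_ind n (P : free_group n -> Prop) :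
    subgroup_prop P -> (forall i, (i < n)%N -> P (free_gen n i)) ->
  forall x, P x.
Proof.
move=> [P1 PM PV] Pgen x; rewrite -(to_quotK x).
elim: (repr x) => [|[j b] w IHw]; first exact: P1.
have -> : to_quot (@free_rel n) ((j, b) :: w)
    = to_quot _ ([:: (j, b)] : word _) * to_quot _ (w : word _).
  by rewrite -to_quotM.
apply: (PM _ _ _ IHw).
have Pj : P (to_quot (@free_rel n) [:: (j, true)]).
  by rewrite -free_genE; apply: Pgen.
case: b => //.
(* The letter [(j, false)] represents the inverse of generator [j]. *)
have /mulg1_eq <- : (to_quot (@free_rel n) [:: (j, true)] : free_group n)
    * (to_quot (@free_rel n) [:: (j, false)] : free_group n) = 1.
  by rewrite -to_quotM; apply/to_quotP/(free_invr (j, true)).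
exact: PV.
Qed.

Lemma free_group_hom n (T : groupType) (m : nat -> T) :
  exists F : {multiplicative free_group n -> T},
    forall i, (i < n)%N -> F (free_gen n i) = m i.
Proof.
pose l (x : free_letter n) := if x.2 then m x.1 else (m x.1)^-1.
pose h (w : word (free_letter n)) : T := \prod_(x <- w) l x.
have hM : {morph h : u v / u * v} by move=> u v; apply: big_cat.
have hR x y : free_rel x y -> h x = h y.
  case=> -[j b]; rewrite /h big_cons big_seq1 big_nil /l /=.
  by case: b => /=; rewrite ?mulgV ?mulVg.
have [F FM Fh] := quot_hom hM hR.
exists (pack_hom (FM : {morph (F : free_group n -> T) : x y / x * y})).
by move=> i lt_in; rewrite (free_genE (Ordinal lt_in)) /= Fh /h big_seq1.
Qed.

(** * Graph products: induction and universal property *)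

Section GraphProduct.
Variables (Gamma : sgraph) (G : Gamma -> groupType).
Implicit Types s t : Gamma.

Definition gp_in s (g : G s) : graph_product G :=
  to_quot (@graph_rel Gamma G) (prod_in g).

Lemma gp_inM s (g h : G s) : gp_in (g * h) = gp_in g * gp_in h.
Proof.
rewrite /gp_in -to_quotM; congr to_quot; rewrite /prod_in -to_quotM.
exact/esym/to_quotP/cong_base/ProdRelM.
Qed.

Lemma gp_in_comm s t (g : G s) (h : G t) :
  edge s t -> commute (gp_in g) (gp_in h).
Proof.
move=> st; have /to_quotP := cong_base (GraphRel g h st).
by rewrite 2!to_quotM.
Qed.

Lemma graph_product_ind (P : graph_product G -> Prop) :
    subgroup_prop P -> (forall s (g : G s), P (gp_in g)) -> forall x, P x.
Proof.
(* A graph product is a quotient of a quotient: the first [repr] lands in the free product, the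
   second in words. *)
move=> [P1 PM PV] Pgen x; rewrite -(to_quotK x) -(to_quotK (repr x)).
elim: (repr (repr x)) => [|[s g] w IHw]; first exact: P1.
have -> : to_quot (@prod_rel Gamma G) (Tagged G g :: w)
    = prod_in g * to_quot _ (w : word _) by rewrite -to_quotM.
by rewrite to_quotM; apply: (PM _ _ _ IHw); apply: Pgen.
Qed.

Lemma graph_product_hom (T : groupType)
    (m : forall s, {multiplicative G s -> T}) :
    (forall s t (g : G s) (h : G t), edge s t -> commute (m s g) (m t h)) ->
  exists F : {multiplicative graph_product G -> T},
    forall s (g : G s), F (gp_in g) = m s g.
Proof.
move=> mC; pose h (w : word (prod_letter G)) : T :=
  \prod_(x <- w) m (tag x) (tagged x).
have hM : {morph h : u v / u * v} by move=> u v; apply: big_cat.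
have hR x y : prod_rel x y -> h x = h y.
  case=> [s g k|s]; rewrite /h ?big_cons ?big_nil /= ?mulg1.
    by rewrite gmulfM.
  by rewrite hom1.
have [F1 F1M F1h] := quot_hom hM hR.
have F1in s (g : G s) : F1 (prod_in g) = m s g.
  by rewrite F1h /h big_seq1.
have F1R x y : graph_rel x y -> F1 x = F1 y.
  by case=> s t g k st; rewrite !F1M !F1in; apply: mC.
have [F FM Fh] := quot_hom F1M F1R.
exists (pack_hom (FM : {morph (F : graph_product G -> T) : x y / x * y})).
by move=> s g; rewrite /= Fh.
Qed.

End GraphProduct.

(** * Graph products of free groups, by generators *)

Section FreeGraphProduct.
Variables (Gamma : sgraph) (rank : Gamma -> nat).
Implicit Types s t : Gamma.

Local Notation GP := (graph_product (fun s => free_group (rank s))).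

Definition gp_gen s (i : nat) : GP :=
  @gp_in Gamma (fun s => free_group (rank s)) s (free_gen (rank s) i).

Lemma gp_gen_comm s t i j : edge s t -> commute (gp_gen s i) (gp_gen t j).
Proof. exact: gp_in_comm. Qed.

Lemma gp_gen_ind (P : GP -> Prop) :
    subgroup_prop P -> (forall s i, (i < rank s)%N -> P (gp_gen s i)) ->
  forall x, P x.
Proof.
move=> Psub Pgen; apply: graph_product_ind => // s.
pose ins : {multiplicative free_group (rank s) -> GP} :=
  pack_hom (@gp_inM Gamma (fun s => free_group (rank s)) s).
apply: free_group_ind => [|i]; last exact: Pgen.
exact: (preim_subgroup ins).
Qed.

Lemma gp_gen_hom (T : groupType) (m : Gamma -> nat -> T) :
    (forall s t i j, edge s t -> (i < rank s)%N -> (j < rank t)%N ->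
       commute (m s i) (m t j)) ->
  exists F : {multiplicative GP -> T},
    forall s i, (i < rank s)%N -> F (gp_gen s i) = m s i.
Proof.
move=> mC.
pose M s := sval (cid (free_group_hom (rank s) (m s))).
have ME s i : (i < rank s)%N -> M s (free_gen _ i) = m s i.
  by move=> lti; rewrite /M; case: cid => F /= ->.
(* Centralizers are subgroups, so commutation passes from generators to vertex groups; this is used
   below on one side, then on the other. *)
have comm_hom s (x : T) :
    (forall i, (i < rank s)%N -> commute x (m s i)) ->
  forall g, commute x (M s g).
  move=> xC; apply: free_group_ind => [|i lti].
    exact/preim_subgroup/commute_subgroup.
  by rewrite ME //; apply: xC.
have [|F FE] := @graph_product_hom Gamma (fun s => free_group (rank s)) T M.
  move=> s t g h st; apply/comm_hom => j ltj.
  by apply/commute_sym/comm_hom => i lti; apply/commute_sym/mC.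
by exists F => s i lti; rewrite /gp_gen FE ME.
Qed.

End FreeGraphProduct.

(** * The wreath product with Z/2 *)

Section Wreath.
Variable K : groupType.

(* The wreath product of K with Z/2: (u, v, e) is the map (k, 0) |-> (u k, e),
   (k, 1) |-> (v k, 1 + e) on K * Z/2, and the product is composition. *)
Definition wreath := (K * K * bool)%type.

HB.instance Definition _ := Choice.on wreath.

Definition wsign (w : wreath) : bool := w.2.
Definition wcoord (w : wreath) (j : bool) : K := if j then w.1.2 else w.1.1.
Definition wbuild (c : bool -> K) (e : bool) : wreath := (c false, c true, e).

Lemma wcoord_build c e j : wcoord (wbuild c e) j = c j.
Proof. by case: j. Qed.

Lemma wreath_eq u v :
  (forall j, wcoord u j = wcoord v j) -> wsign u = wsign v -> u = v.
Proof.
case: u v => [[u0 u1] e] [[v0 v1] d] uv; rewrite /wsign /= => ->.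
by move: (uv false) (uv true); rewrite /wcoord /= => -> ->.
Qed.

Definition wmul (u v : wreath) : wreath :=
  wbuild (fun j => wcoord u (j (+) wsign v) * wcoord v j) (wsign u (+) wsign v).
Definition wone : wreath := wbuild (fun _ => 1) false.
Definition winv (u : wreath) : wreath :=
  wbuild (fun j => (wcoord u (j (+) wsign u))^-1) (wsign u).

Fact wmulA : associative wmul.
Proof.
move=> u v w; apply: wreath_eq => [j|]; last exact: addbA.
by rewrite !wcoord_build mulgA /wsign /= addbAC -addbA [_ (+) w.2]addbC.
Qed.

Fact wmul1 : left_id wone wmul.
Proof. by move=> u; apply: wreath_eq => // j; rewrite !wcoord_build mul1g. Qed.

Fact wmulr1 : right_id wone wmul.
Proof.
move=> u; apply: wreath_eq => [j|]; last exact: addbF.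
by rewrite !wcoord_build mulg1 addbF.
Qed.

Fact wmulV : left_inverse wone winv wmul.
Proof.
move=> u; apply: wreath_eq => [j|]; last exact: addbb.
by rewrite !wcoord_build /wsign /= addbK mulVg.
Qed.

Fact wmulrV : right_inverse wone winv wmul.
Proof.
move=> u; apply: wreath_eq => [j|]; last exact: addbb.
by rewrite !wcoord_build /wsign /= mulgV.
Qed.

HB.instance Definition _ := isMonoid.Build wreath wmulA wmul1 wmulr1.
HB.instance Definition _ := hasInv.Build wreath winv.
HB.instance Definition _ := Monoid_isGroup.Build wreath wmulV wmulrV.

Lemma wcoordM (u v : wreath) j :
  wcoord (u * v) j = wcoord u (j (+) wsign v) * wcoord v j.
Proof. exact: wcoord_build. Qed.

Lemma wsignM (u v : wreath) : wsign (u * v) = wsign u (+) wsign v.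
Proof. by []. Qed.

Lemma wcoordV (u : wreath) j :
  wcoord u^-1 j = (wcoord u (j (+) wsign u))^-1.
Proof. exact: wcoord_build. Qed.

Lemma wsignV (u : wreath) : wsign u^-1 = wsign u.
Proof. by []. Qed.

Lemma wcoord1 j : wcoord 1 j = 1.
Proof. exact: wcoord_build. Qed.

End Wreath.

(** * The doubled graph and its rigidity *)

Section Doubling.
Variables (Gamma : sgraph) (s0 : Gamma).
Implicit Types s t : Gamma.

(** The complement of the star of [s0]: the vertices that get two copies. *)
Definition far s := (s != s0) && ~~ edge s s0.

Lemma farNedge s : far s -> edge s s0 = false.
Proof. by case/andP=> _ /negPf. Qed.

(* The vertices shared by the two copies are represented on sheet false only. *)
Definition double_vertex : finType := {x : Gamma * bool | x.2 ==> far x.1}.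
Implicit Types v w : double_vertex.

Definition base v : Gamma := (val v).1.
Definition sheet v : bool := (val v).2.

(** The last two disjuncts join vertices of the link of [s0], stored on sheet [false], to both
    sheets. They also cover the edges at [s0], whose other end is in that link. *)
Definition double_edge : rel double_vertex := fun v w =>
  edge (base v) (base w) &&
    [|| sheet v == sheet w, edge (base v) s0 | edge (base w) s0].

Fact double_edge_sym : symmetric double_edge.
Proof.
move=> v w; rewrite /double_edge edge_sym eq_sym; congr (_ && (_ || _)).
exact: orbC.
Qed.

Fact double_edge_irrefl : irreflexive double_edge.
Proof. by move=> v; rewrite /double_edge edge_irrefl. Qed.

Definition double : sgraph := SGraph double_edge_sym double_edge_irrefl.

Fact lift_subproof (i : bool) s : (s, i && far s).2 ==> far (s, i && far s).1.
Proof. by apply/implyP=> /andP[]. Qed.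

(** The embedding of [Gamma] as copy [i]; the conjunct [far s] sends the star of [s0] to the shared
    sheet. *)
Definition lift i s : double := exist _ (s, i && far s) (lift_subproof i s).

Lemma base_lift i s : base (lift i s) = s. Proof. by []. Qed.

Lemma sheet_lift i s : sheet (lift i s) = i && far s. Proof. by []. Qed.

Lemma lift_base v : lift (sheet v) (base v) = v.
Proof.
apply: val_inj; case: v => -[s i] si; rewrite /= /sheet /base /=.
by case: i si => //= far_s; rewrite far_s.
Qed.

Lemma sheet_far v : sheet v -> far (base v).
Proof. exact: (implyP (valP v)). Qed.

Lemma edge_lift i s t : edge s t -> edge (lift i s) (lift i t).
Proof.
move=> st; apply/andP; split; first exact: st.
rewrite /base /sheet /=.
case sL: (edge s s0); first by rewrite orbT.
case tL: (edge t s0); first by rewrite !orbT.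
(* With neither end in the link of [s0], neither end is [s0] itself, so both are far and lie on
   sheet [i]. *)
rewrite !orbF /far sL tL !andbT; case: i => //=.
case: (eqVneq s s0) => [s_s0|_]; first by rewrite -s_s0 edge_sym st in tL.
by case: (eqVneq t s0) => // t_s0; rewrite -t_s0 st in sL.
Qed.

Lemma edge_lift_base s (v : double) :
  edge s (base v) -> edge (lift (sheet v) s) v.
Proof. by move/(edge_lift (sheet v)); rewrite lift_base. Qed.

(** By finiteness, [lift false] followed by a bijection [f] would already exhaust [Gamma], leaving
    no value for the second copy of [t0]. *)
Lemma double_not_isomorphic t0 : far t0 -> ~ graph_isomorphic double Gamma.
Proof.
move=> far_t0 [f [g fK gK] _].
have inj : injective (f \o lift false).
  by move=> s t /= /(can_inj fK) /(congr1 val) [].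
have [h _ hK] := injF_bij inj.
have := hK (f (lift true t0)).
by move=> /= /(can_inj fK) /(congr1 sheet); rewrite /sheet /= far_t0.
Qed.

Lemma rigidP (Delta : sgraph) :
  rigid Delta <->
  forall s t : Delta, (forall u : Delta, edge u s -> edge u t) -> t = s.
Proof.
have link2P (s t : Delta) :
    reflect (forall u : Delta, edge u s -> edge u t) (t \in link (link1 s)).
  apply: (iffP bigcapP) => st u; have := st u; rewrite !inE => st' us.
    by rewrite edge_sym st'.
  by rewrite edge_sym st'.
split=> [rig s t /link2P|rig s]; first by rewrite rig => /set1P.
by apply/setP=> t; rewrite inE; apply/link2P/eqP => [/rig|->].
Qed.

(** An inclusion of links projects to [Gamma], so by rigidity [v] and [w] can differ only in their
    sheet. *)
Lemma double_rigid : rigid Gamma -> rigid double.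
Proof.
move=> /rigidP rig; apply/rigidP => v w vw.
have base_eq : base w = base v.
  by apply: rig => s /edge_lift_base /vw /andP[].
suff sheet_eq : sheet w = sheet v.
  by rewrite -(lift_base w) sheet_eq base_eq lift_base.
apply/eqP/negPn/negP => neq_sheet.
have far_v : far (base v).
  move: neq_sheet; case iv: (sheet v); first by rewrite sheet_far.
  by case iw: (sheet w) => // _; rewrite -base_eq sheet_far.
(* Otherwise link (base v) would be contained in link s0. *)
have : s0 = base v.
  apply: rig => s s_v; have /vw/andP[_] := edge_lift_base s_v.
  rewrite base_eq (farNedge far_v) orbF.
  case/orP=> [/eqP eq_sheet|//].
  case: (boolP (edge s s0)) => // sL.
  case: (eqVneq s s0) => [s_s0|s_s0].
    by have := farNedge far_v; rewrite edge_sym -s_s0 s_v.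
  (* The lift of such an [s] to the sheet of [v] is adjacent to [v], hence to [w], which forces
     equal sheets. *)
  have far_s : far s by rewrite /far s_s0 sL.
  by rewrite -eq_sheet sheet_lift far_s andbT eqxx in neq_sheet.
by move=> s0v; move: far_v; rewrite -s0v /far eqxx.
Qed.

(** * The two homomorphisms on generators *)

Definition double_rank (v : double) : nat := if base v == s0 then 3 else 2.

Local Notation G := (graph_product (fun _ : Gamma => free_group 2)).
Local Notation K :=
  (graph_product (fun v : double => free_group (double_rank v))).

Definition gG (s : Gamma) (i : nat) : G := gp_gen (fun=> 2) s i.
Definition gK (v : double) (i : nat) : K := gp_gen double_rank v i.
Local Notation a := (gG s0 0).
Local Notation b := (gG s0 1).

Definition sigma (i : bool) (g : G) : G := if i then g ^ a else g.

(** At [s0], the default of [nth] is the third generator, of index 2. *)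
Definition fgen (v : double) (i : nat) : G :=
  if base v == s0 then nth (b ^ a) [:: a * a; b] i
  else sigma (sheet v) (gG (base v) i).

(** Left multiplication written on [k] and [a k]: [a] maps them to [a k] and [a^2 k], while any
    other generator [g] gives [g k] and [a (a^-1 g a) k]. At [s0], the default of [nth] is the value
    at [b]. *)
Definition psigen (s : Gamma) (i : nat) : wreath K :=
  if s == s0 then
    nth (gK (lift false s0) 1, gK (lift false s0) 2, false)
      [:: (1, gK (lift false s0) 0, true)] i
  else (gK (lift false s) i, gK (lift true s) i, false).

Lemma gG_comm s t i j : edge s t -> commute (gG s i) (gG t j).
Proof. exact: gp_gen_comm. Qed.

Lemma sigma_fix s i j : edge s s0 -> sigma j (gG s i) = gG s i.
Proof.
by case: j => // sL; rewrite /sigma conjgE (gG_comm i 0 sL) mulKg.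
Qed.

(** A link vertex lifts to sheet [false] for both [k], but it commutes with [a], so [sigma k] fixes
    its generators. *)
Lemma fgen_lift k s i : s != s0 -> fgen (lift k s) i = sigma k (gG s i).
Proof.
rewrite /fgen base_lift sheet_lift => s_s0; rewrite (negPf s_s0) /far s_s0 /=.
case sL: (edge s s0); last by rewrite andbT.
by rewrite !sigma_fix.
Qed.

Lemma fgen_comm_s0 v w i j :
  base v = s0 -> edge (base w) s0 -> commute (fgen v i) (fgen w j).
Proof.
move=> v_s0 wL; apply: commute_sym; rewrite /fgen v_s0 eqxx.
case: eqP wL => [->|_ wL]; first by rewrite edge_irrefl.
rewrite sigma_fix //; have wC k := gG_comm j k wL.
case: i => [|[|i]] /=; rewrite ?nth_nil ?conjgE //; first exact: commuteM.
by apply: commuteM; [apply: commuteV|apply: commuteM].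
Qed.

Lemma fgen_comm (v w : double) i j : edge v w -> commute (fgen v i) (fgen w j).
Proof.
case/andP=> vw sheets.
case: (eqVneq (base v) s0) => [v_s0|v_s0].
  by apply: fgen_comm_s0 => //; rewrite edge_sym -v_s0.
case: (eqVneq (base w) s0) => [w_s0|w_s0].
  by apply/commute_sym/fgen_comm_s0 => //; rewrite -w_s0.
rewrite /fgen (negPf v_s0) (negPf w_s0).
have sigmaC k : commute (sigma k (gG (base v) i)) (sigma k (gG (base w) j)).
  case: k; last exact: gG_comm.
  by rewrite /commute /sigma -!conjMg gG_comm.
(* On equal sheets both ends are conjugated alike; an end in the link of [s0] is fixed by [sigma],
   so it can be given the sheet of the other end. *)
case/or3P: sheets => [/eqP->//|vL|wL].
  by rewrite !(sigma_fix _ _ vL) -(sigma_fix i (sheet w) vL).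
by rewrite !(sigma_fix _ _ wL) -(sigma_fix j (sheet v) wL).
Qed.

Lemma psigen_comm s t i j :
  edge s t -> commute (psigen s i) (psigen t j).
Proof.
(* Adjacent vertices are not both [s0], so by symmetry [t] is not. *)
wlog t_s0 : s t i j / t != s0.
  move=> wl st; case: (eqVneq t s0) => [t_s0|ts]; last exact: wl.
  apply/commute_sym/wl; last by rewrite edge_sym.
  by apply: contraTneq st => ->; rewrite t_s0 edge_irrefl.
move=> st; rewrite /psigen (negPf t_s0).
have gKC k : commute (gK (lift k s) i) (gK (lift k t) j).
  exact/gp_gen_comm/edge_lift.
case: eqVneq => [s_s0|_]; last first.
  by apply: wreath_eq => // -[]; rewrite !wcoordM; apply: gKC.
(* The sign of [a] swaps the two coordinates; they agree here because a neighbour of [s0] has a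
   single copy. *)
have tE k : lift k t = lift false t.
  by apply: val_inj; rewrite /= /far edge_sym -s_s0 st !andbF.
rewrite (tE true) => {gKC}.
have gKC k : commute (gK (lift false s0) k) (gK (lift false t) j).
  by apply/gp_gen_comm/edge_lift; rewrite -s_s0.
case: i => [|i]; rewrite /= ?nth_nil; apply: wreath_eq => // -[];
  by rewrite !wcoordM /wcoord /= ?mulg1 ?mul1g //; apply: gKC.
Qed.

Lemma gK_hom : exists f : {multiplicative K -> G},
  forall v i, (i < double_rank v)%N -> f (gK v i) = fgen v i.
Proof. by apply: gp_gen_hom => v w i j vw _ _; apply: fgen_comm. Qed.

Lemma gG_hom : exists psi : {multiplicative G -> wreath K},
  forall s i, (i < 2)%N -> psi (gG s i) = psigen s i.
Proof. by apply: gp_gen_hom => s t i j st _ _; apply: psigen_comm. Qed.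

(** * The isomorphism onto the kernel, and its index *)

Section Iso.
Variable f : {multiplicative K -> G}.
Hypothesis fE : forall v i, (i < double_rank v)%N -> f (gK v i) = fgen v i.
Variable psi : {multiplicative G -> wreath K}.
Hypothesis psiE : forall s i, (i < 2)%N -> psi (gG s i) = psigen s i.

Definition even_part : {pred G} := fun g => ~~ wsign (psi g).

(** On elements of sign [false], the coordinate at [false] is multiplicative, so generators
    suffice. *)
Lemma psi_f (k : K) : wsign (psi (f k)) = false /\ wcoord (psi (f k)) false = k.
Proof.
elim/gp_gen_ind: k => [|v i lti].
  split=> [|x y [xs xE] [ys yE]|x [xs xE]]; first by rewrite !hom1.
  - by rewrite !gmulfM wsignM wcoordM xs ys addFb xE yE.
  - by rewrite !homV wsignV wcoordV xs addFb xE.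
rewrite -/(gK v i) fE // /fgen; move: lti; rewrite /double_rank.
case: eqP => [v_s0|v_s0] lti.
  have -> : v = lift false s0.
    rewrite -(lift_base v) v_s0; apply: val_inj => /=.
    by rewrite /far eqxx andbF.
  by case: i lti => [|[|[|i]]] //= _;
    rewrite ?conjgE ?gmulfM ?homV !psiE // /psigen eqxx /= ?wcoordM ?wsignM
      ?wcoordV ?wsignV /wcoord /wsign /= ?mulg1 ?mul1g ?invg1 ?mul1g ?mulg1.
rewrite -[in gK v i](lift_base v) /sigma; move/eqP/negPf: v_s0 => v_s0.
by case: (sheet v); rewrite ?conjgE ?gmulfM ?homV !psiE // /psigen ?eqxx v_s0
  /= ?wcoordM ?wsignM ?wcoordV ?wsignV /wcoord /wsign /= ?invg1 ?mul1g ?mulg1.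
Qed.

(* For g of sign e, the action of psi g says g a^j = a^(j + e) f(wcoord j). *)
Lemma f_psi (g : G) (j : bool) :
  g * a ^+ j = a ^+ (j (+) wsign (psi g)) * f (wcoord (psi g) j).
Proof.
move: j; elim/gp_gen_ind: g => [|s i lti].
  split=> [j|x y xE yE j|x xE j].
  - by rewrite hom1 addbF wcoord1 hom1 mul1g mulg1.
  - rewrite -mulgA yE gmulfM wsignM wcoordM gmulfM !mulgA xE.
    by rewrite [wsign _ (+) wsign _]addbC addbA.
  - rewrite homV wsignV wcoordV homV; apply: (mulgI x); rewrite mulVKg mulgA xE.
    by rewrite addbK mulgK.
rewrite -/(gG s i) psiE // /psigen; case: eqVneq => [->|s_s0] j; last first.
  have fK k : f (gK (lift k s) i) = sigma k (gG s i).
    by rewrite fE ?fgen_lift // /double_rank base_lift (negPf s_s0).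
  (* For [j] true the identity is [g * a = a * g ^ a]. *)
  by case: j; rewrite /wsign /wcoord /= fK /= ?mulg1 ?mul1g // -conjgC.
have fK k : (k < 3)%N -> f (gK (lift false s0) k) = nth (b ^ a) [:: a * a; b] k.
  by move=> ltk; rewrite fE /fgen /double_rank base_lift eqxx.
by case: i lti => [|[|i]] // _; case: j;
  rewrite /wsign /wcoord /= ?fK ?hom1 //= ?mulg1 ?mul1g // -conjgC.
Qed.

Lemma even_part_group : group_closed even_part.
Proof.
split=> [|x y]; rewrite !unfold_in; first by rewrite hom1.
by rewrite gmulfM homV wsignM wsignV => /negPf-> /negPf->.
Qed.

(** The left cosets are the two fibres [C] of the sign, which contain [1] and [a]; the test [n == 1]
    turns the indices 0 and 1 into signs. *)
Lemma even_part_index : has_index even_part 2.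
Proof.
pose C (e : bool) : set G := [set g | wsign (psi g) = e]%classic.
have cosetE g : lcoset_of even_part g = C (wsign (psi g)).
  apply/seteqP; split=> [_ [h /negPf hP <-]|h hP] /=.
    by rewrite /C /= gmulfM wsignM hP addbF.
  exists (g^-1 * h); last by rewrite mulVKg.
  by rewrite /= unfold_in gmulfM homV wsignM wsignV hP addbb.
have sign_a : wsign (psi a) by rewrite psiE // /psigen eqxx.
have sign_1 : wsign (psi 1) = false by rewrite hom1.
have Cinj : {in `I_2%classic &, injective (fun n => C (n == 1%N))}.
  move=> m n; rewrite !inE => lt_m2 lt_n2 /seteqP[Cmn Cnm].
  case: m n lt_m2 lt_n2 Cmn Cnm => [|[|m]] [|[|n]] // _ _ /=.
    by move=> /(_ _ sign_1); rewrite /C /= sign_1.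
  by move=> _ /(_ _ sign_1); rewrite /C /= sign_1.
rewrite /has_index.
suff -> : range (lcoset_of even_part) = [set C (n == 1%N) | n in `I_2]%classic.
  exact: inj_card_eq.
apply/seteqP; split=> [_ [g _ <-]|_ [n /= lt_n2 <-]].
  by exists (wsign (psi g)); rewrite ?cosetE //=; case: wsign.
case: n lt_n2 => [|[|n]] // _; [exists 1|exists a] => //; rewrite cosetE.
  by rewrite sign_1.
by rewrite sign_a.
Qed.

(** [psi_f] gives the image inclusion and injectivity; [f_psi] at [false] writes an element of sign
    [false] as a value of [f]. *)
Lemma even_part_iso : isomorphic_to_subgroup K even_part.
Proof.
exists f; split=> [k _|k l _ _ kl|g /= gH].
- by rewrite /= unfold_in; have [-> _] := psi_f k.
- by have [_ <-] := psi_f k; rewrite kl; have [_ ->] := psi_f l.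
- exists (wcoord (psi g) false) => //; have := f_psi g false.
  by move/negPf: gH => ->; rewrite mulg1 mul1g => <-.
Qed.

End Iso.

End Doubling.

Theorem corollary6p7 (Gamma : sgraph) (hGamma : ~ complete Gamma) :
  exists (Gamma' : sgraph) (rank : Gamma' -> nat),
    [/\ forall s : Gamma', rank s = 2 \/ rank s = 3,
        ~ graph_isomorphic Gamma' Gamma,
        exists H : {pred graph_product (fun _ : Gamma => free_group 2)},
          [/\ group_closed H,
              has_index H 2 &
              isomorphic_to_subgroup
                (graph_product (fun s : Gamma' => free_group (rank s))) H]
      & rigid Gamma -> rigid Gamma'].
Proof.
have [t0 [s0 far_t0]] : exists t0 s0 : Gamma, far s0 t0.
  apply: contrapT => no_far; apply: hGamma => t s neq_ts.
  by apply/negPn/negP => ts; apply: no_far; exists t, s; rewrite /far neq_ts.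
(* Doubling along the star of [s0] duplicates [t0], which is what makes the graph larger. *)
exists (double s0), (@double_rank Gamma s0); split.
- by move=> v; rewrite /double_rank; case: ifP; [right|left].
- exact: double_not_isomorphic far_t0.
- have [f fE] := gK_hom s0; have [psi psiE] := gG_hom s0.
  exists (even_part psi); split.
  + exact: even_part_group.
  + exact: even_part_index psiE.
  + by apply: (even_part_iso (f := f)).
- exact: double_rigid.
Qed.
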